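(* Let $\alpha,\beta>0$, $n\ge2$ and $N=\binom n2$. Let $\tau_j(i)$ be the time it takes for the dynamic Erdős–Rényi graph on $n$ vertices, starting with $j$ edges, to reach $i$ edges, where $j<i$. Then, for every $0\le i\le N-1$, $$\mathbb{E}(\tau_i(i+1))=\frac{(n-1)(N-i-1)!\,i!}{\beta N!}\sum_{k=0}^{i}\binom{N}{i-k}\left(\frac{\alpha}{\beta}(n-1)\right)^k,$$ and, for all $0\le j<i\le N$, $$\mathbb{E}(\tau_j(i))=\sum_{m=j}^{i-1}\frac{(n-1)(N-m-1)!\,m!}{\beta N!}\sum_{k=0}^{m}\binom{N}{m-k}\left(\frac{\alpha}{\beta}(n-1)\right)^k.$$
   Context: Dynamic Erdős–Rényi graph: for $\alpha,\beta>0$ and an integer $n\ge2$, there are $n$ fixed vertices and, independently for each of the $N=\binom n2$ vertex pairs, if no edge is present an edge is added after an exponentially distributed time with rate $\frac{\beta}{n-1}$, and if an edge is present it is removed after an exponentially distributed time with rate $\alpha$. Let $\eta(t)$ be the number of edges present at time $t$; $\{\eta(t)\}$ is a birth–death process on $\{0,1,\dots,N\}$ with birth rates $\lambda_k=(N-k)\frac{\beta}{n-1}$ and death rates $\mu_k=k\alpha$. For $i,j\in\{0,\dots,N\}$, $\tau_j(i)=\inf\{t>0:\eta(t)=i\}$ when $\eta(0)=j$. *)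

(* Defs.v *)
From HB Require Import structures.
From mathcomp Require Import all_boot all_order all_algebra.
From mathcomp Require Import all_classical all_reals all_analysis.

Set Implicit Arguments.
Unset Strict Implicit.
Unset Printing Implicit Defensive.

Import Order.TTheory GRing.Theory Num.Theory.
Import numFieldNormedType.Exports.

Local Open Scope ring_scope.

Notation vpair n := {e : {set 'I_n} | #|e| == 2%N}.

Definition mutually_independent (R : realType) (d : measure_display)
    (T : measurableType d) (P : probability T R) (I : eqType)
    (X : I -> {RV P >-> R}) : Prop :=
  forall (J : seq I) (A : I -> set R), uniq J ->
    (forall i, measurable (A i)) ->
    P (\bigcap_(i in [set` J]) X i @^-1` A i)%classic =
    (\prod_(i <- J) P (X i @^-1` A i)%classic)%E.

Definition jump_time (R : realType) (h : nat -> R) (k : nat) : R :=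
  \sum_(l < k) h l.

(* Exactly k jumps have occurred by time t.  When the holding times h are
   nonnegative the first conjunct is just jump_time h k <= t; quantifying over
   l keeps k unique even on the null event where some holding time is
   negative. *)
Definition jumps_by (R : realType) (h : nat -> R) (t : R) (k : nat) : Prop :=
  (forall l, (l <= k)%N -> jump_time h l <= t) /\ t < jump_time h k.+1.

Definition edge_status (R : realType) (b : bool) (h : nat -> R) (t : R) : bool :=
  `[< exists k, jumps_by h t k /\ b (+) odd k >].

Definition transition_rate (R : realType) (n : nat) (alpha beta : R)
    (present : bool) : R :=
  if present then alpha else beta / (n%:R - 1).

(* X is a dynamic Erdos-Renyi graph started from G0.  H e k is the time that
   the vertex pair e spends in its k-th successive status (present or absent);
   the status of e alternates, so the k-th one is (e \in G0) (+) odd k. *)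
Definition dynamic_ER (R : realType) (d : measure_display)
    (T : measurableType d) (P : probability T R) (n : nat) (alpha beta : R)
    (G0 : {set vpair n}) (X : R -> T -> {set vpair n}) : Prop :=
  exists H : vpair n -> nat -> {RV P >-> R},
    [/\ mutually_independent (fun ek : vpair n * nat => H ek.1 ek.2),
        forall e k (A : set R), measurable A ->
          distribution P (H e k) A =
          exponential_prob
            (transition_rate n alpha beta ((e \in G0) (+) odd k)) A
      & forall (t : R) (w : T), 0 <= t -> forall e,
          (e \in X t w) = edge_status (e \in G0) (fun k => H e k w) t].

(* +oo if the process never has i edges at a positive time. *)
Definition hitting_time (R : realType) (T : Type) (n : nat)
    (X : R -> T -> {set vpair n}) (i : nat) (w : T) : \bar R :=
  ereal_inf [set t%:E | t in [set t : R | 0 < t /\ #|X t w| = i]]%classic.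

(* Main.v *)
Require Import Defs.
From HB Require Import structures.
From mathcomp Require Import all_boot all_order all_algebra.
From mathcomp Require Import all_classical all_reals all_analysis.
From mathcomp Require Import ring lra measurable_realfun.

Set Implicit Arguments.
Unset Strict Implicit.
Unset Printing Implicit Defensive.

Import Order.TTheory GRing.Theory Num.Theory.
Import numFieldNormedType.Exports.

Local Open Scope ring_scope.

(** The mean passage time solves a first-jump equation.  With N edges in all,
    lambda = beta / (n - 1), and k < i edges present, the next jump comes after
    a mean time 1 / q, where q = (N - k) lambda + k alpha, and adds or removes
    an edge with probabilities (N - k) lambda / q and k alpha / q.  If e_k is
    the mean time from k to k + 1 edges this says
    (N - k) lambda e_k = 1 + k alpha e_(k-1), which the closed formula
    satisfies (passage_recurrence); the passage from j to i is the sum of the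
    one-step passages.

    Two things have to be supplied.  The first is the regeneration of the
    process at its jumps, since the process is given pathwise, by independent
    exponential holding times of each vertex pair.  At the first jump, made by
    the pair e, the holding time of e is used up and the current holding time
    of every other pair is shortened by the elapsed time.  On the event that e
    jumps first, these residual times are again independent exponentials, with
    the rates of the new graph, and they are independent of the elapsed time,
    which is exponential of rate q (independent_exponentials_jump).  This is
    obtained by letting e race against the other pairs one after the other:
    each race is a computation with two variables (exponential_race), after
    which the winner carries the sum of the rates.  Because independence is
    expressed relative to an event of known mass
    (independent_exponentials), the races can be iterated by shrinking the
    event, on a fixed probability space and with fixed sample paths.

    The second is that the first-jump equation determines the mean: it has to
    be shown that the process does reach i edges and that no mass escapes.  Let
    a_m be the mean time elapsed until i edges are reached or m jumps are made,
    and p_m the probability that i edges are not reached in m jumps.  Both obey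
    the first-jump recursion.  If g is the solution of the linear system,
    comparison by induction on m gives a_m <= g <= C, g - a_m <= C p_m and
    m p_m <= Q a_m, where Q bounds all jump rates (mean_time_bounds).  So
    p_m <= Q C / m tends to 0 and a_m tends to g.  On a path that reaches i
    edges in finitely many jumps the hitting time is the elapsed time
    (hitting_time_elapsed), and monotone convergence concludes. *)

(** * The exponential law *)

Section exponential_law.
Variable R : realType.
Notation mu := (@lebesgue_measure R).

(** The measure structure on [exponential_prob r] depends on a proof that [r] is
    positive, which cannot be inferred; this packages it. *)
Definition exponential_law (r : R) (hr : 0 < r) :
  probability (measurableTypeR R) R.
Proof. refine [the probability _ _ of exponential_prob r]; exact: hr. Defined.

Lemma exponential_lawE (r : R) (hr : 0 < r) A :
  exponential_law hr A = exponential_prob r A.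
Proof. by []. Qed.

Lemma exponential_prob_neg (r : R) (A : set R) :
  (A `<=` `]-oo, 0[)%classic -> exponential_prob r A = 0%E.
Proof.
move=> A0; rewrite /exponential_prob integral0_eq// => x /A0/=.
by rewrite in_itv/= => x0; rewrite lt0_exponential_pdf.
Qed.

Lemma exponential_prob_set1 (r x : R) :
  exponential_prob r [set x]%classic = 0%E.
Proof. by rewrite /exponential_prob integral_set1. Qed.

Lemma exponential_prob_nonpos (r : R) (hr : 0 < r) :
  exponential_prob r `]-oo, 0%R]%classic = 0%E.
Proof.
rewrite (_ : `]-oo, 0%R] = `]-oo, 0%R[ `|` [set 0])%classic; last first.
  apply/seteqP; split => x; rewrite /= !in_itv/=; last by case=> [/ltW|->].
  by rewrite le_eqVlt => /predU1P[->|x0]; [right|left].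
rewrite (measureU (exponential_law hr))//; last first.
  by rewrite -subset0 => x /= []; rewrite in_itv/= => /[swap] ->; rewrite ltxx.
by rewrite /= exponential_prob_set1 (@exponential_prob_neg _ `]-oo,
  0[%classic)// adde0.
Qed.

Lemma exponential_prob_tail (r : R) (hr : 0 < r) (t : R) : 0 <= t ->
  exponential_prob r `]t, +oo[%classic = (expR (- r * t))%:E.
Proof.
move=> t0.
have H s : 0 < s -> exponential_prob r `]s, +oo[%classic = (expR (- r * s))%:E.
  move=> s0.
  have := probability_setT (exponential_law hr).
  rewrite -(setUv (`]s, +oo[%classic : set (measurableTypeR R))) measureU//;
    last 2 first.
    exact: measurableC.
    exact: setICr.
  rewrite setCitvr (_ : `]-oo, s]%classic = (`]-oo, 0%R[ `|` `[0%R,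
    s])%classic); last first.
    by rewrite -itv_bndbnd_setU//= ?bnd_simp ?ltW.
  rewrite (measureU (exponential_law hr))//; last first.
    by rewrite -subset0 => x [/=]; rewrite !in_itv/= => x0 /andP[];
      rewrite leNgt x0.
  rewrite /= exponential_prob_itv0c// (@exponential_prob_neg _ `]-oo,
    0[%classic)// add0e.
  have : exponential_prob r `]s, +oo[%classic \is a fin_num.
    by rewrite -(exponential_lawE hr) fin_num_measure.
  move/fineK => <-; rewrite -EFinB -EFinD => -[] /(congr1 (fun x => x + expR (-
    r * s) - 1)).
  by move=> h; congr EFin; move: h; lra.
move: t0; rewrite le_eqVlt => /predU1P[<-|]; last exact: H.
rewrite mulr0 expR0.
have := probability_setT (exponential_law hr).
rewrite (_ : setT = `]-oo, 0%R[ `|` [set 0] `|` `]0%R, +oo[)%classic;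
  last first.
  apply/seteqP; split => x//= _; rewrite !in_itv/= andbT.
  by case: (ltgtP x 0) => [xx|xx|->]; [left; left|right|left; right].
rewrite measureU//; last 2 first.
- by apply: measurableU.
- rewrite -subset0 => x /= [[|]]; rewrite !in_itv/= ?andbT; last by move=> ->;
  rewrite ltxx.
  by move=> x0 /(lt_trans x0); rewrite ltxx.
rewrite measureU//; last first.
  by rewrite -subset0 => x /= []; rewrite in_itv/= => /[swap] ->; rewrite ltxx.
by rewrite /= exponential_prob_set1 (@exponential_prob_neg _ `]-oo,
  0[%classic)// !add0e.
Qed.

(** Both sides are finite measures in [A], so it is enough to compare them on
    the half-lines, where the tail formula turns the claim into
    exp (- r (x + t)) = exp (- r x) exp (- r t). *)
Lemma exponential_prob_memoryless (r : R) (hr : 0 < r) (x : R)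
    (A : set (measurableTypeR R)) : 0 <= x -> measurable A ->
  exponential_prob r [set y | x < y /\ A (y - x)] =
  ((expR (- r * x))%:E * exponential_prob r A)%E.
Proof.
move=> x0 mA.
have mx : measurable (`]x, +oo[%classic : set (measurableTypeR R)) by [].
pose sub := (fun y : measurableTypeR R => y - x : measurableTypeR R).
have msub : measurable_fun setT sub by exact: measurable_funB.
pose m1 := pushforward (mrestr (exponential_law hr) mx) sub.
pose e : {nonneg R} := NngNum (expR_ge0 (- r * x)).
pose m2 := mscale e (exponential_law hr).
suff : m1 A = m2 A.
  rewrite /m1 /m2 /pushforward /mrestr /mscale/= => <-; congr exponential_prob.
  by apply/seteqP; split => y/=; rewrite in_itv/= andbT => -[].
apply: (@measure_unique _ R (measurableTypeR R) (@RGenOInfty.G R)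
  (fun n : nat => `](- n%:R : R), +oo[%classic)) => //.
- exact: RGenOInfty.measurableE.
- move=> _ _ [a ->] [b ->]; exists (Num.max a b).
  by apply/seteqP; split => y/=; rewrite !in_itv/= !andbT gt_max => /andP.
- by move=> n; exists (- n%:R).
- apply/seteqP; split => // y _.
  have [n _ hn] : exists2 n : nat, True & - y < n%:R.
    exists (Num.bound `|y|) => //.
    by rewrite (le_lt_trans (ler_norm _))// normrN; exact: archi_boundP.
  by exists n => //=; rewrite in_itv/= andbT ltrNl.
- move=> _ [t ->].
  change (exponential_prob r ((sub @^-1` `]t, +oo[) `&` `]x, +oo[)%classic =
    ((expR (- r * x))%:E * exponential_prob r `]t, +oo[%classic)%E).
  rewrite [X in exponential_prob r X](_ : _ = `](x + Num.max t 0),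
    +oo[)%classic; last first.
    apply/seteqP; split => y/=; rewrite !in_itv/= !andbT.
    - by case=> h1 h2; rewrite -ltrBrDl gt_max h1/= subr_gt0.
    - by rewrite -ltrBrDl gt_max => /andP[-> ]; rewrite subr_gt0.
  (* the maximum with 0 is there because the law has no mass below 0 *)
  rewrite (@exponential_prob_tail r hr (x + Num.max t 0)); last first.
    by rewrite addr_ge0// le_max lexx orbT.
  rewrite mulrDr expRD EFinM; congr (_ * _)%E.
  have [t0|t0] := leP t 0.
    rewrite mulr0 expR0; apply/eqP; rewrite eq_le.
    apply/andP; split; last exact: (probability_le1 (exponential_law hr)).
    have := exponential_prob_tail hr (lexx 0); rewrite mulr0 expR0 => <-.
    apply: (le_measure (exponential_law hr)); rewrite ?inE//.
    by move=> y/=; rewrite !in_itv/= !andbT; apply: le_lt_trans.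
  by rewrite exponential_prob_tail// ltW.
- move=> n.
  pose B := ((sub @^-1` `](- n%:R : R), +oo[) `&` `]x, +oo[)%classic.
  change (exponential_law hr B < +oo)%E.
  rewrite (@le_lt_trans _ _ 1%E) ?ltry// probability_le1//.
  apply: measurableI => //.
  by rewrite -[X in measurable X]setTI; exact: msub.
Qed.

Lemma exponential_law_dominates (r : R) (hr : 0 < r) :
  exponential_law hr `<< mu.
Proof.
apply/null_content_dominatesP => A mA muA0.
rewrite exponential_lawE /exponential_prob; apply: null_set_integral => //.
by apply/measurable_funTS/measurableT_comp => //;
  exact: measurable_exponential_pdf.
Qed.

(** The density of the law is a version of its Radon-Nikodym derivative, which
    gives the usual change of variables. *)
Lemma integral_exponential_law (r : R) (hr : 0 < r) (f : R -> \bar R) :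
  (exponential_law hr).-integrable setT f ->
  (\int[exponential_law hr]_x f x =
   \int[mu]_x (f x * (exponential_pdf r x)%:E))%E.
Proof.
move=> intf.
have mf := measurable_int _ intf.
rewrite -(Radon_Nikodym_change_of_variables (exponential_law_dominates hr))//=.
apply: ae_eq_integral => //.
- apply: emeasurable_funM => //; apply: (measurable_int mu).
  by apply: Radon_Nikodym_integrable; exact: exponential_law_dominates.
- apply: emeasurable_funM => //=; apply/measurableT_comp => //=.
  exact: measurable_exponential_pdf.
- apply: ae_eqe_mul2l => /=.
  rewrite Radon_NikodymE//=; first exact: exponential_law_dominates.
  move=> dom; case: cid => /= h [h1 h2 h3].
  apply: integral_ae_eq => //=.
  + by apply/measurableT_comp => //; exact: measurable_exponential_pdf.
  + by move=> E _ mE; rewrite -h3.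
Qed.

End exponential_law.

(** * The race of two exponential clocks *)

Section race.
Variable R : realType.
Notation mu := (@lebesgue_measure R).

(** The mean 1 / q of an exponential variable, for a variable that is known to
    be exponential only on an event of mass [c].  The tail formula reduces it to
    the total mass of the density: the integral of c exp (- q r) over r >= 0 is
    c / q times that of q exp (- q r). *)
Lemma integral_exponential_on_event d (T : measurableType d)
    (P : probability T R) (D : set T) (X : T -> R) (q c : R) (hq : 0 < q) :
  measurable D -> measurable_fun setT X -> (forall w, D w -> 0 <= X w) ->
  (forall A : set R, measurable A ->
     P (D `&` X @^-1` A)%classic = (c%:E * exponential_prob q A)%E) ->
  (\int[P]_(w in D) (X w)%:E = (c / q)%:E)%E.
Proof.
move=> mD mX X0 PX.
have c0 : 0 <= c.
  have := PX _ measurableT.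
  rewrite preimage_setT setIT -(exponential_lawE hq) probability_setT mule1.
  by rewrite -lee_fin => <-.
pose Y := (X \* \1_D : T -> R)%R.
have mY : measurable_fun setT Y.
  by apply: measurable_funM => //; exact: measurable_indic.
pose Y' : {RV P >-> R} := HB.pack Y (isMeasurableFun.Build _ _ _ _ _ mY).
have Y0 w : 0 <= Y' w.
  (* Y' is a packed function; exposing the product lets the indicator reduce *)
  change (0 <= X w * \1_D w); rewrite indicE; case: (boolP (w \in D)) => [|_];
    last by rewrite mulr0.
  by rewrite inE mulr1; exact: X0.
have <- : ('E_P[Y'] = \int[P]_(w in D) (X w)%:E)%E.
  rewrite unlock [RHS]integral_mkcond; apply: eq_integral => w _.
  by rewrite epatch_indic/= EFinM.
rewrite ge0_expectation_ccdf//.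
transitivity (\int[mu]_(r in `[0%R, +oo[)
  ((c / q)%:E * (exponential_pdf q r)%:E))%E.
  apply: eq_integral => r; rewrite inE/= in_itv/= andbT => r0.
  rewrite /ccdf /distribution /pushforward.
  rewrite (_ : _ @^-1` _ = D `&` X @^-1` `]r, +oo[)%classic; last first.
    apply/seteqP; split => w.
      change ((X w * \1_D w) \in `]r, +oo[ ->
        (D `&` X @^-1` `]r, +oo[)%classic w).
      rewrite /= !in_itv/= !andbT indicE.
      case: (boolP (w \in D)) => [|_]; first by rewrite inE mulr1.
      by rewrite mulr0 ltNge r0.
    change ((D `&` X @^-1` `]r, +oo[)%classic w ->
      (X w * \1_D w) \in `]r, +oo[).
    by move=> [wD]; rewrite /= !in_itv/= !andbT indicE mem_set//= mulr1.
  rewrite PX// exponential_prob_tail// -!EFinM; congr EFin.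
  rewrite exponential_pdfE// mulrA -(mulrA c) mulVf ?mulr1//.
  by rewrite gt_eqF.
have mp := measurable_exponential_pdf q.
have p0 (x : R) : (0 <= (exponential_pdf q x)%:E)%E.
  by rewrite lee_fin exponential_pdf_ge0// ltW.
rewrite ge0_integralZl//; last 2 first.
- by apply/measurable_funTS/measurable_EFinP.
- by rewrite lee_fin divr_ge0// ltW.
rewrite -[X in (_ * X)%E]/(exponential_prob q `[0, +oo[%classic).
have := probability_setT (exponential_law hq).
rewrite -(setUv (`[0, +oo[%classic : set (measurableTypeR R))) measureU//;
  last 2 first.
- exact: measurableC.
- exact: setICr.
by rewrite setCitvr/= (@exponential_prob_neg _ _ `]-oo, 0[%classic)// adde0 =>
  ->; rewrite mule1.
Qed.

Lemma measurable_race (A B : set (measurableTypeR R)) :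
  measurable A -> measurable B ->
  measurable ([set p | [/\ A p.1, p.1 < p.2 & B (p.2 - p.1)]]%classic :
    set (measurableTypeR R * measurableTypeR R)).
Proof.
move=> mA mB.
pose R2 := (measurableTypeR R * measurableTypeR R)%type.
pose sub (p : R2) := (p.2 - p.1 : measurableTypeR R).
have mlt : measurable [set p : R2 | p.1 < p.2].
  have := @measurable_fun_ltr _ R2 R setT fst snd
    measurable_fst measurable_snd measurableT [set true]%classic I.
  by rewrite setTI.
have msub : measurable_fun setT sub.
  exact: (@measurable_funB _ R2 R setT snd fst measurable_snd measurable_fst).
rewrite [X in measurable X](_ : _ =
    (fst @^-1` A) `&` [set p | p.1 < p.2] `&` (sub @^-1` B))%classic; last first.
  by apply/seteqP; split => p/=; [case|case=> -[]].
apply: measurableI; last by rewrite -[X in measurable X]setTI; exact: msub.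
by apply: measurableI => //; rewrite -[X in measurable X]setTI;
  exact: measurable_fst.
Qed.

(** The heart of the regeneration argument.  Given that the first clock rings
    at time x and the second one later, which has probability exp (- b x), the
    residual time of the second clock is a fresh exponential by lack of memory.
    Absorbing the factor exp (- b x) into the density of the first clock turns
    a exp (- a x) into a / (a + b) times the density of rate a + b. *)
Lemma exponential_race (a b : R) (ha : 0 < a) (hb : 0 < b)
    (A B : set (measurableTypeR R)) :
  measurable A -> measurable B ->
  (exponential_law ha \x exponential_law hb)%E
     [set p | [/\ A p.1, p.1 < p.2 & B (p.2 - p.1)]]%classic =
  ((a / (a + b))%:E * exponential_prob (a + b) A * exponential_prob b B)%E.
Proof.
move=> mA mB.
set C := [set p | _]%classic.
have mC : measurable C by exact: measurable_race.
have xC x : 0 <= x -> exponential_prob b (xsection C x) =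
    ((\1_A x * expR (- b * x))%:E * exponential_prob b B)%E.
  move=> x0; rewrite indicE; case: (boolP (x \in A)) => xA.
    rewrite mul1r -exponential_prob_memoryless//; congr exponential_prob.
    apply/seteqP; split => y; rewrite xsectionE/= /C/=; first by case.
    by move=> []; split => //; rewrite inE in xA.
  rewrite mul0r mul0e (_ : xsection C x = set0)//; last first.
    apply/seteqP; split => y //; rewrite xsectionE/= /C/= => -[Ax _ _].
    by move/negP: xA; rewrite inE.
  by rewrite -(exponential_lawE hb) measure0.
rewrite /product_measure1.
have mxC : measurable_fun setT (exponential_law hb \o xsection C).
  exact: measurable_fun_xsection.
rewrite integral_exponential_law; last first.
  apply: (@le_integrable _ _ _ _ _ measurableT _ (EFin \o cst 1)) => //.
    move=> x _ /=; rewrite normr1 gee0_abs;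
      last exact: (measure_ge0 (exponential_law hb)).
    apply: (@probability_le1 _ _ _ (exponential_law hb));
      exact: measurable_xsection.
  exact: (finite_measure_integrable_cst (exponential_law ha) 1 measurableT).
have fB : exponential_prob b B \is a fin_num by rewrite -(exponential_lawE hb)
  fin_num_measure.
have ab0 : 0 < a + b by rewrite addr_gt0.
have p0 (x : R) : (0 <= (exponential_pdf (a + b) x)%:E)%E.
  by rewrite lee_fin exponential_pdf_ge0// ltW.
have mp := @measurable_exponential_pdf R (a + b).
transitivity (\int[mu]_x ((a / (a + b))%:E * exponential_prob b B *
   ((fun x => (exponential_pdf (a + b) x)%:E) \_ A) x))%E.
  apply: eq_integral => x _ /=.
  have [x0|x0] := ltP x 0.
    rewrite patchE !lt0_exponential_pdf// mule0; case: ifPn => _;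
      by rewrite ?mule0.
  rewrite xC// epatch_indic !exponential_pdfE//=.
  rewrite -(fineK fB) -!EFinM; congr EFin.
  have -> : expR (- (a + b) * x) = expR (- b * x) * expR (- a * x).
    by rewrite -expRD -mulrDl; congr (expR (_ * _)); ring.
  by field; rewrite gt_eqF.
rewrite ge0_integralZl//; last 3 first.
- apply/measurable_restrict => //; apply/measurable_funTS.
  exact/measurable_EFinP.
- by move=> x _; rewrite patchE; case: ifP.
- rewrite mule_ge0//; first by rewrite lee_fin divr_ge0// ltW.
  exact: (measure_ge0 (exponential_law hb)).
rewrite -integral_mkcond -/(exponential_prob (a + b) A).
by rewrite muleAC.
Qed.

End race.

(** * Independent exponential families on an event *)

Section independence_on_event.
Local Open Scope classical_set_scope.
Variables (R : realType) (d : measure_display) (T : measurableType d).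
Variable P : probability T R.

(** Two variables that are independent on the event [F] have there, up to the
    factor [P F], the product law: it is determined by the rectangles. *)
Lemma joint_law (F : set T) (U V : T -> R)
    (mu nu : probability (measurableTypeR R) R) :
  measurable F -> measurable_fun setT U -> measurable_fun setT V ->
  (forall A B : set R, measurable A -> measurable B ->
     P (F `&` (U @^-1` A `&` V @^-1` B)) = (P F * (mu A * nu B))%E) ->
  forall C : set (measurableTypeR R * measurableTypeR R), measurable C ->
    P (F `&` (fun w => (U w, V w)) @^-1` C) = (P F * (mu \x nu) C)%E.
Proof.
move=> mF mU mV PUV C mC.
pose UV := fun w : T => (U w, V w) : measurableTypeR R * measurableTypeR R.
have mUV : measurable_fun setT UV by exact: measurable_fun_pair.
have PF0 : 0 <= fine (P F) by apply: fine_ge0.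
pose m1 := pushforward (mrestr P mF) UV.
pose m2 := mscale (NngNum PF0) (mu \x nu)%E.
have m2E A : m2 A = (P F * (mu \x nu) A)%E.
  by rewrite /m2 /mscale/= fineK// fin_num_measure.
rewrite -m2E setIC; change (m1 C = m2 C).
apply: (@measure_unique _ R (measurableTypeR R * measurableTypeR R)%type
  [set C | exists A, measurable A /\ exists B, measurable B /\ C = A `*` B]
  (fun=> setT)) => //.
- rewrite measurable_prod_measurableType; congr (<<s _ >>).
  apply/seteqP; split => [_ [A mA [B mB <-]]|_ [A [mA [B [mB ->]]]]].
    by exists A; split => //; exists B.
  by exists A => //; exists B.
- move=> _ _ [A1 [mA1 [B1 [mB1 ->]]]] [A2 [mA2 [B2 [mB2 ->]]]].
  rewrite -setXI; exists (A1 `&` A2); split; first exact: measurableI.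
  by exists (B1 `&` B2); split => //; exact: measurableI.
- by move=> _; exists setT; split => //; exists setT; split => //;
  rewrite setXTT.
- by rewrite bigcup_const//; exists 0%N.
- move=> _ [A [mA [B [mB ->]]]].
  rewrite [RHS]m2E product_measure1E// -PUV//.
  by rewrite /m1 /pushforward /mrestr/= setIC.
- move=> _; change (P (UV @^-1` setT `&` F) < +oo)%E.
  by rewrite preimage_setT setTI; apply: (le_lt_trans (probability_le1 P mF));
    exact: ltry.
Qed.

(** On the event [D], which has probability [c] (take [J] empty), the variables
    [X i] are independent and exponential of rates [rho i].  Keeping the event
    and its mass, instead of conditioning on it, lets the event shrink at each
    race without any renormalization. *)
Definition independent_exponentials (D : set T) (c : R) (I : eqType)
    (X : I -> T -> R) (rho : I -> R) : Prop :=
  forall (J : seq I) (A : I -> set R), uniq J -> (forall i, measurable (A i)) ->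
    P (D `&` \bigcap_(i in [set` J]) X i @^-1` A i) =
    (c%:E * \prod_(i <- J) exponential_prob (rho i) (A i))%E.

Lemma independent_exponentials_mass D c (I : eqType) (Y : I -> T -> R) rho :
  independent_exponentials D c Y rho -> P D = c%:E.
Proof.
move=> /(_ [::] (fun=> setT) isT (fun=> measurableT)).
by rewrite set_nil bigcap_set0 setIT big_nil mule1.
Qed.

Section eq_index.
Variables (I : eqType).
Implicit Types (X : I -> T -> R) (rho : I -> R) (J L : seq I).

(** The product rule need only be checked on the families that contain a given
    finite list [L]: indices of [L] outside the family can be added with the
    trivial constraint [setT], which contributes a factor 1. *)
Lemma independent_exponentials_extend L D c X rho :
  uniq L -> (forall i, 0 < rho i) ->
  (forall J (A : I -> set R), uniq (L ++ J) -> (forall i, measurable (A i)) ->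
    P (D `&` \bigcap_(i in [set` L ++ J]) X i @^-1` A i) =
    (c%:E * \prod_(i <- L ++ J) exponential_prob (rho i) (A i))%E) ->
  independent_exponentials D c X rho.
Proof.
move=> uL rho0 H J A uJ mA.
pose J2 := L ++ [seq j <- J | j \notin L].
pose A2 i := if i \in J then A i else setT.
have uJ2 : uniq J2.
  rewrite cat_uniq uL filter_uniq// andbT/=; apply/hasPn => x.
  by rewrite mem_filter => /andP[].
have JJ2 i : i \in J -> i \in J2.
  by move=> iJ; rewrite mem_cat mem_filter iJ andbT orbN.
transitivity (P (D `&` \bigcap_(i in [set` J2]) X i @^-1` A2 i)).
  congr (P (D `&` _)); apply/seteqP; split => w h i /=.
    by rewrite /A2 => _; case: ifPn => // iJ; exact: h.
  by move=> iJ; have := h i (JJ2 _ iJ); rewrite /A2/= iJ.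
rewrite H//; last by move=> i; rewrite /A2; case: ifP.
congr (_ * _)%E.
transitivity (\prod_(i <- J2 | i \in J) exponential_prob (rho i) (A i))%E.
  rewrite [RHS]big_mkcond; apply: eq_bigr => i _; rewrite /A2;
    case: ifP => // _.
  by rewrite -(exponential_lawE (rho0 i)) probability_setT.
rewrite -big_filter; apply: perm_big; apply: uniq_perm => //.
  exact: filter_uniq.
by move=> i; rewrite mem_filter; case: (boolP (i \in J)) => // /JJ2 ->.
Qed.

(** If [s] beats [y], then [s] takes over the rate of [y] and [y] restarts from
    its residual time, while all variables stay independent. *)
Lemma independent_exponentials_race (s y : I) D c X rho :
  s != y -> (forall i, 0 < rho i) -> measurable D ->
  (forall i, measurable_fun setT (X i)) ->
  independent_exponentials D c X rho ->
  independent_exponentials (D `&` [set w | X s w < X y w])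
    (c * (rho s / (rho s + rho y)))
    (fun i => if i == y then X y \- X s else X i)
    (fun i => if i == s then rho s + rho y else rho i).
Proof.
move=> sy rho0 mD mX ind.
apply: (@independent_exponentials_extend [:: s; y]).
- by rewrite /= inE sy.
- by move=> i; case: ifP => // _; rewrite addr_gt0.
move=> J A uJ mA.
have [sJ yJ uJ'] : [/\ s \notin J, y \notin J & uniq J].
  by move: uJ; rewrite /= inE negb_or => /and3P[/andP[]].
pose F := D `&` \bigcap_(i in [set` J]) X i @^-1` A i.
have mXA i (B : set R) : measurable B -> measurable (X i @^-1` B).
  by move=> mB; rewrite -[X in measurable X]setTI; exact: mX.
have mF : measurable F.
  apply: measurableI => //; apply: fin_bigcap_measurable => // i _.
  exact: mXA.
have PF : P F = (c%:E * \prod_(i <- J) exponential_prob (rho i) (A i))%E by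
  exact: ind.
have PUV A0 B0 : measurable A0 -> measurable B0 ->
    P (F `&` (X s @^-1` A0 `&` X y @^-1` B0)) =
    (P F * (exponential_law (rho0 s) A0 * exponential_law (rho0 y) B0))%E.
  move=> mA0 mB0.
  (* the rectangle constraint on (s, y), together with that of F on the rest *)
  pose A2 i := if i == s then A0 else if i == y then B0 else A i.
  have mA2 i : measurable (A2 i) by rewrite /A2; do 2?case: ifP.
  have A2J i : i \in J -> A2 i = A i.
    by move=> iJ; rewrite /A2 (negbTE (memPn sJ _ iJ)) (negbTE (memPn yJ _ iJ)).
  have A2s : A2 s = A0 by rewrite /A2 eqxx.
  have A2y : A2 y = B0 by rewrite /A2 eq_sym (negbTE sy) eqxx.
  transitivity (P (D `&` \bigcap_(i in [set` [:: s; y] ++ J]) X i @^-1` A2 i)).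
    congr (P _); apply/seteqP; split => w.
      move=> [[Dw h] [As By]]; split => // i /=.
      rewrite !inE => /or3P[/eqP->|/eqP->|iJ]; rewrite ?A2s ?A2y//.
      by rewrite A2J//; exact: h.
    move=> [Dw h]; split; [split => // i /= iJ|split].
    - by rewrite -(A2J _ iJ); apply: h; rewrite /= !inE iJ !orbT.
    - by rewrite -A2s; apply: h; rewrite /= !inE eqxx.
    - by rewrite -A2y; apply: h; rewrite /= !inE eqxx orbT.
  rewrite ind// !big_cons PF A2s A2y -muleA; congr (_ * _)%E.
  rewrite [in RHS]muleC muleA; congr (_ * _)%E.
  by apply: eq_big_seq => i iJ; rewrite A2J.
pose C : set (measurableTypeR R * measurableTypeR R) :=
  [set p | [/\ A s p.1, p.1 < p.2 & A y (p.2 - p.1)]].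
transitivity (P (F `&` (fun w => (X s w, X y w)) @^-1` C)).
  congr (P _); apply/seteqP; split => w.
    move=> [[Dw sw] h]; split.
      split => // i /= iJ.
      have := h i; rewrite /= !inE iJ !orbT (negbTE (memPn yJ _ iJ)).
      by apply.
    split => //=.
      by have := h s; rewrite /= !inE eqxx (negbTE sy); apply.
    by have := h y; rewrite /= !inE eqxx orbT; apply.
  move=> [[Dw h] [/= As sw Ay]]; split => // i.
  rewrite /= !inE; case: (eqVneq i s) => [->|ns]/=;
    first by rewrite (negbTE sy).
  by case: (eqVneq i y) => [->|ny]//= iJ; exact: h.
rewrite (joint_law mF (mX s) (mX y) PUV);
  last exact: (measurable_race (mA s) (mA y)).
rewrite (exponential_race _ _ (mA s) (mA y)) PF !big_cons eqxx eq_sym (negbTE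
  sy).
rewrite [in RHS](eq_big_seq (fun i => exponential_prob (rho i) (A i)));
  last first.
  by move=> i iJ /=; rewrite (negbTE (memPn sJ _ iJ)).
rewrite (EFinM c); move: (rho s / _) => k; move: (\prod_(i <- J) _)%E => u.
by rewrite -!muleA; congr (_ * _)%E; rewrite muleC -!muleA.
Qed.

(** The opponents in [L] are beaten one at a time.  The probabilities
    telescope, because [s] enters each race with the rates of all opponents
    beaten so far. *)
Lemma independent_exponentials_race_all (s : I) L D c X rho :
  uniq (s :: L) -> (forall i, 0 < rho i) -> measurable D ->
  (forall i, measurable_fun setT (X i)) ->
  independent_exponentials D c X rho ->
  independent_exponentials (D `&` [set w | {in L, forall y, X s w < X y w}])
    (c * (rho s / (rho s + \sum_(y <- L) rho y)))
    (fun i => if i \in L then X i \- X s else X i)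
    (fun i => if i == s then rho s + \sum_(y <- L) rho y else rho i).
Proof.
move=> + rho0 mD mX ind; elim: L => [_|y L IH].
  have -> : D `&` [set w | {in [::], forall y, X s w < X y w}] = D.
    by apply/seteqP; split => w // -[].
  rewrite big_nil addr0 divff ?gt_eqF// mulr1.
  have -> : (fun i => if i == s then rho s else rho i) = rho => //.
  by apply/funext => i; case: eqP => // ->.
rewrite [uniq _]/= inE negb_or -!andbA => /and4P[sy sL yL uL].
have sLu : uniq (s :: L) by rewrite /= sL.
set S := \sum_(z <- L) rho z in IH *.
have S0 : 0 <= S by apply: sumr_ge0 => i _; exact: ltW.
pose E := D `&` [set w | {in L, forall z, X s w < X z w}].
pose Y i := if i \in L then X i \- X s else X i.
pose sigma i := if i == s then rho s + S else rho i.
have mXlt z : measurable [set w | X s w < X z w].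
  have := measurable_fun_ltr (mX s) (mX z) measurableT
    (Logic.I : measurable [set true]).
  by rewrite setTI.
have mE : measurable E.
  apply: measurableI => //.
  have -> : [set w | {in L, forall z, X s w < X z w}] =
            \bigcap_(z in [set` L]) [set w | X s w < X z w] by [].
  exact: fin_bigcap_measurable.
have mY i : measurable_fun setT (Y i).
  by rewrite /Y; case: ifP => // _; exact: measurable_funB.
have sigma0 i : 0 < sigma i.
  by rewrite /sigma; case: ifP => // _; rewrite ltr_pwDl.
have := independent_exponentials_race sy sigma0 mE mY (IH sLu).
have Ys : Y s = X s by rewrite /Y (negbTE sL).
have Yy : Y y = X y by rewrite /Y (negbTE yL).
have sigmas : sigma s = rho s + S by rewrite /sigma eqxx.
have sigmay : sigma y = rho y by rewrite /sigma eq_sym (negbTE sy).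
rewrite Ys Yy sigmas sigmay.
have -> : E `&` [set w | X s w < X y w] =
    D `&` [set w | {in y :: L, forall z, X s w < X z w}].
  apply/seteqP; split => w.
    by move=> [[Dw h] hy]; split => // z; rewrite inE => /predU1P[->//|];
      exact: h.
  move=> [Dw h]; split; last by apply: h; rewrite mem_head.
  by split => // z zL; apply: h; rewrite inE zL orbT.
have -> : c * (rho s / (rho s + S)) * ((rho s + S) / (rho s + S + rho y)) =
    c * (rho s / (rho s + \sum_(z <- y :: L) rho z)).
  rewrite big_cons -/S (addrC (rho y)) addrA.
  have rS : rho s + S != 0 by rewrite gt_eqF// ltr_pwDl.
  have rSy : rho s + S + rho y != 0 by rewrite gt_eqF// !ltr_wpDr// ltW.
  by field; rewrite rS rSy.
have -> : (fun i => if i == y then X y \- X s else Y i) =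
    (fun i => if i \in y :: L then X i \- X s else X i).
  by apply/funext => i; rewrite inE /Y; case: eqVneq => //= ->.
have -> // : (fun i => if i == s then rho s + S + rho y else sigma i) =
    (fun i => if i == s then rho s + \sum_(z <- y :: L) rho z else rho i).
apply/funext => i; rewrite big_cons -/S (addrC (rho y)) addrA /sigma.
by case: eqP.
Qed.

End eq_index.

Lemma independent_exponentials_comp (I I' : eqType) (f : I' -> I) (g : I -> I')
    D c (X : I -> T -> R) (rho : I -> R) :
  cancel f g -> independent_exponentials D c X rho ->
  independent_exponentials D c (X \o f) (rho \o f).
Proof.
move=> fK ind J A uJ mA.
have := ind (map f J) (A \o g).
rewrite map_inj_uniq ?big_map; last exact: can_inj fK.
move=> /(_ uJ (fun i => mA (g i))) H.
transitivity (c%:E * \prod_(i <- J) exponential_prob (rho (f i)) ((A \o g)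
    (f i)))%E; last first.
  by congr (_ * _)%E; apply: eq_bigr => i _ /=; rewrite fK.
rewrite -H; congr (P (D `&` _)); apply/seteqP; split => w h i /=.
  by move=> /mapP[j jJ ->] /=; rewrite fK; exact: h.
move=> iJ; have := h (f i); rewrite /= fK; apply.
by rewrite map_f.
Qed.

End independence_on_event.

(** * First-jump decomposition *)

Section race_functionals.
Variables (R : realType) (E : finType).
Implicit Types (G : {set E}) (h : E -> nat -> R) (e x : E).

Definition toggle G e : {set E} := [set x | (x \in G) (+) (x == e)].

(** Strict inequalities make these events disjoint for distinct [e]; ties have
    probability zero. *)
Definition jumps_first h e : bool :=
  [forall x, (x != e) ==> (h e 0%N < h x 0%N)].

(** The holding times still to come just after the first jump, when [e] makes
    it. *)
Definition residual e h : E -> nat -> R := fun x k =>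
  if x == e then h x k.+1
  else if k == 0%N then h x 0%N - h e 0%N else h x k.

(** The path is followed until [i] edges are present, for at most [m] jumps,
    paying [kappa] per unit of time, and [b] if [i] edges are reached.  Two
    cases matter: with [kappa = 1] and [b = 0] this is the time elapsed when the
    path is stopped, with [kappa = 0] and [b = 1] it is the indicator that [i]
    edges are reached within [m] jumps.  A path with a tie at some jump is
    charged 0 from there on. *)
Fixpoint stopped_cost (i : nat) (kappa b : R) (m : nat) G h : R :=
  if #|G| == i then b
  else if m is m'.+1 then
    \sum_e (jumps_first h e)%:R *
       (kappa * h e 0%N + stopped_cost i kappa b m' (toggle G e) (residual e h))
  else 0.

Lemma jumps_firstP h e :
  reflect (forall x, x != e -> h e 0%N < h x 0%N) (jumps_first h e).
Proof.
apply: (iffP forallP) => H x; last by apply/implyP/H.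
by apply/implyP/H.
Qed.

Lemma residual_gt0 e h : jumps_first h e -> (forall x k, 0 < h x k) ->
  forall x k, 0 < residual e h x k.
Proof.
move=> /jumps_firstP he h0 x k; rewrite /residual; case: eqVneq => // xe.
by case: eqP => // _; rewrite subr_gt0 he.
Qed.

Lemma stopped_cost_ge0 i kappa b m G h : 0 <= kappa -> 0 <= b ->
  (forall x k, 0 < h x k) -> 0 <= stopped_cost i kappa b m G h.
Proof.
move=> k0 b0; elim: m G h => [|m IH] G h h0 /=; case: ifP => // _.
apply: sumr_ge0 => e _; case: (boolP (jumps_first h e)) => he;
  last by rewrite mul0r.
rewrite mul1r addr_ge0//; first by rewrite mulr_ge0// ltW.
by apply: IH; exact: residual_gt0.
Qed.

Section rates.
Variable rate : bool -> R.

(** The rates of all holding times of a process started from [G], as each pair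
    alternates between the two statuses. *)
Definition status_rate G (ek : E * nat) : R :=
  rate ((ek.1 \in G) (+) odd ek.2).

Definition total_rate G : R := \sum_x rate (x \in G).

(** The first-jump recursion obeyed by the mean of [stopped_cost]; see
    [integral_stopped_cost]. *)
Fixpoint mean_cost (i : nat) (kappa b : R) (m : nat) G : R :=
  if #|G| == i then b
  else if m is m'.+1 then
    kappa / total_rate G +
    \sum_e rate (e \in G) / total_rate G * mean_cost i kappa b m' (toggle G e)
  else 0.

End rates.
End race_functionals.

Section race_expectation.
Local Open Scope classical_set_scope.
Variables (R : realType) (d : measure_display) (T : measurableType d).
Variables (P : probability T R) (E : finType) (rate : bool -> R).
Hypothesis rate_gt0 : forall s, 0 < rate s.
Implicit Types (G : {set E}) (e x : E) (X : E -> nat -> T -> R).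

Let status_rate_gt0 G ek : 0 < status_rate rate G ek.
Proof. exact: rate_gt0. Qed.

Let total_rate_gt0 G e : 0 < total_rate rate G.
Proof.
rewrite /total_rate (bigD1 e)//= ltr_pwDl// sumr_ge0// => x _.
exact: ltW.
Qed.

Definition sample X (w : T) : E -> nat -> R := fun x k => X x k w.
Definition residual_family e X : E -> nat -> T -> R :=
  fun x k w => residual e (sample X w) x k.

Lemma measurable_residual e X : (forall x k, measurable_fun setT (X x k)) ->
  forall x k, measurable_fun setT (residual_family e X x k).
Proof.
move=> mX x k; rewrite /residual_family /residual; case: (x == e);
  first exact: mX.
case: (k == 0%N); last exact: mX.
exact: (measurable_funB (mX x 0%N) (mX e 0%N)).
Qed.

Lemma measurable_jumps_first e X : (forall x k, measurable_fun setT (X x k)) ->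
  measurable [set w | jumps_first (sample X w) e].
Proof.
move=> mX.
have -> : [set w | jumps_first (sample X w) e] =
    \bigcap_(x in [set` [pred x | x != e]]) [set w | X e 0%N w < X x 0%N w].
  apply/seteqP; split => w /=; first by move/jumps_firstP => H x; exact: H.
  by move=> H; apply/jumps_firstP => x; exact: H.
apply: fin_bigcap_measurable => [|x _]; first exact: finite_finpred.
have := measurable_fun_ltr (mX e 0%N) (mX x 0%N) measurableT
  (I : measurable [set true]).
by rewrite setTI.
Qed.

Lemma measurable_jumps_first_indicator e X :
  (forall x k, measurable_fun setT (X x k)) ->
  measurable_fun setT (fun w => (jumps_first (sample X w) e)%:R : R).
Proof.
move=> mX.
have -> : (fun w => (jumps_first (sample X w) e)%:R : R) =
    \1_[set w | jumps_first (sample X w) e].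
  apply/funext => w; rewrite indicE; congr (_ %:R).
  by congr nat_of_bool; apply/idP/idP; rewrite inE.
exact/measurable_indic/measurable_jumps_first.
Qed.

Lemma measurable_stopped_cost i kappa b m G X :
  (forall x k, measurable_fun setT (X x k)) ->
  measurable_fun setT (fun w => stopped_cost i kappa b m G (sample X w)).
Proof.
elim: m G X => [|m IH] G X mX /=; case: (_ == i) => //.
apply: measurable_sum => e.
apply: measurable_funM; first exact: measurable_jumps_first_indicator.
apply: measurable_funD.
  exact: (measurable_funM (measurable_cst kappa) (mX e 0%N)).
by apply: (IH _ (residual_family e X)); exact: measurable_residual.
Qed.

(** Regeneration at the first jump: on the event that [e] jumps first, whose
    relative mass is its share of the total rate, the residual holding times
    are those of a process started from the new graph, and the time of the jump
    is exponential with the total rate. *)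
Lemma independent_exponentials_jump e G D c X :
  measurable D -> (forall x k, measurable_fun setT (X x k)) ->
  independent_exponentials P D c (fun ek => X ek.1 ek.2) (status_rate rate G) ->
  let D' := D `&` [set w | jumps_first (sample X w) e] in
  let c' := c * (rate (e \in G) / total_rate rate G) in
  independent_exponentials P D' c' (fun ek => residual_family e X ek.1 ek.2)
    (status_rate rate (toggle G e)) /\
  (forall A : set R, measurable A -> P (D' `&` X e 0%N @^-1` A) =
     (c'%:E * exponential_prob (total_rate rate G) A)%E).
Proof.
move=> mD mX ind D' c'.
pose L : seq (E * nat) := [seq (x, 0%N) | x <- index_enum E & x != e].
pose s : E * nat := (e, 0%N).
have memL x k : ((x, k) \in L) = (x != e) && (k == 0%N).
  apply/mapP/andP => [[y]|[xe /eqP->]].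
    by rewrite mem_filter => /andP[ye _] [-> ->].
  by exists x => //; rewrite mem_filter xe mem_index_enum.
have usL : uniq (s :: L).
  rewrite /= memL eqxx/= map_inj_uniq ?filter_uniq ?index_enum_uniq//.
  by move=> x y [].
have qE : status_rate rate G s + \sum_(y <- L) status_rate rate G y =
    total_rate rate G.
  rewrite big_map big_filter/= /total_rate [RHS](bigD1 e)//=.
  by congr (_ + _); [|apply: eq_bigr => x _]; rewrite /status_rate/= addbF.
have D'E : D' = D `&` [set w | {in L, forall y, X s.1 s.2 w < X y.1 y.2 w}].
  congr (_ `&` _); apply/seteqP; split => w /=.
    by move/jumps_firstP => H [x k]; rewrite memL => /andP[xe /eqP->]; exact: H.
  by move=> H; apply/jumps_firstP => x xe; apply: (H (x, 0%N)); rewrite memL xe.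
have := independent_exponentials_race_all usL (status_rate_gt0 G) mD
  (fun ek => mX ek.1 ek.2) ind.
rewrite qE -D'E {1}/status_rate/= addbF -/c' => ind'.
split; last first.
  move=> A mA; have := ind' [:: s] (fun=> A) isT (fun=> mA).
  rewrite big_seq1 eqxx => <-; congr (P (_ `&` _)).
  apply/seteqP; split => w /=.
    by move=> Aw i; rewrite /= inE => /eqP->; rewrite memL eqxx.
  by move/(_ s); rewrite /= inE eqxx memL eqxx; apply.
(* The current holding time of e is dropped, so its later ones move down by
   one index; g is a left inverse of this reindexing. *)
pose f (xk : E * nat) := (xk.1, if xk.1 == e then xk.2.+1 else xk.2).
pose g (xk : E * nat) := (xk.1, if xk.1 == e then xk.2.-1 else xk.2).
have fK : cancel f g by move=> [x k]; rewrite /f /g/=; case: (x == e).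
have := independent_exponentials_comp fK ind'.
set Y := (_ \o f); set sigma := (_ \o f).
have -> : Y = fun ek => residual_family e X ek.1 ek.2.
  apply/funext => -[x k]; rewrite /Y /f /= memL /residual_family /residual.
  by case: eqVneq => //= _; case: eqVneq => //= ->.
have -> // : sigma = status_rate rate (toggle G e).
apply/funext => -[x k]; rewrite /sigma /f /= /status_rate/= xpair_eqE inE.
case: eqVneq => //= [->|_]; last by rewrite addbF.
by rewrite addbT addNb addbN.
Qed.

(** Each jump restricts [D] to a smaller event on which the residual family is
    of the same kind, so the induction runs over events and families with the
    probability space fixed.  Positivity of the holding times on [D] is carried
    along so that all integrands are nonnegative. *)
Lemma integral_stopped_cost i kappa b m G D c X : 0 <= kappa -> 0 <= b ->
  measurable D -> (forall x k, measurable_fun setT (X x k)) ->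
  (forall w, D w -> forall x k, 0 < X x k w) ->
  independent_exponentials P D c (fun ek => X ek.1 ek.2) (status_rate rate G) ->
  (\int[P]_(w in D) (stopped_cost i kappa b m G (sample X w))%:E =
   (c * mean_cost rate i kappa b m G)%:E)%E.
Proof.
move=> kappa0 b0; elim: m G D c X => [|m IH] G D c X mD mX X0 ind /=.
all: have PD : P D = c%:E by exact: independent_exponentials_mass ind.
all: case: (#|G| == i); first by rewrite integral_cst// EFinM [LHS]muleC;
  congr (_ * _)%E; exact: PD.
  by rewrite integral0_eq ?mulr0.
have mC := measurable_stopped_cost.
under eq_integral do rewrite -sumEFin.
rewrite ge0_integral_sum//; last 2 first.
- move=> e; apply/measurable_funTS/measurable_EFinP.
  apply: measurable_funM; first exact: measurable_jumps_first_indicator.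
  apply: measurable_funD.
    exact: (measurable_funM (measurable_cst kappa) (mX e 0%N)).
  by apply: (mC _ _ _ _ _ (residual_family e X)); exact: measurable_residual.
- move=> e w Dw; rewrite lee_fin.
  case: (boolP (jumps_first (sample X w) e)) => fe; last by rewrite mul0r.
  have Xw0 := X0 w Dw.
  rewrite mul1r addr_ge0//; first by rewrite mulr_ge0// ltW//; exact: Xw0.
  by rewrite stopped_cost_ge0//; apply: residual_gt0.
rewrite mulrDr mulr_sumr.
transitivity (\sum_e
    (c * (rate (e \in G) / total_rate rate G) * (kappa / total_rate rate G) +
     c * (rate (e \in G) / total_rate rate G *
          mean_cost rate i kappa b m (toggle G e)))%:E)%E.
  apply: eq_bigr => e _.
  have [ind' PX] := independent_exponentials_jump e mD mX ind.
  set D' := D `&` _ in ind' PX.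
  set c' := c * _ in ind' PX *.
  have mD' : measurable D' by apply: measurableI => //;
    exact: measurable_jumps_first.
  have mX' := measurable_residual e mX.
  have X0' w : D' w -> forall x k, 0 < residual_family e X x k w.
    by move=> [Dw fw] x k; apply: residual_gt0 => // {}x {}k; exact: X0.
  transitivity (\int[P]_(w in D') (kappa * X e 0%N w +
      stopped_cost i kappa b m (toggle G e)
        (sample (residual_family e X) w))%:E)%E.
    rewrite integral_mkcondr; apply: eq_integral => w _.
    rewrite patchE; case: ifPn => [|]; first by rewrite inE/= => ->;
      rewrite mul1r.
    by rewrite notin_setE/= => /negP/negbTE ->; rewrite mul0r.
  under eq_integral do rewrite EFinD.
  rewrite ge0_integralD//; last 4 first.
  + by move=> w [Dw _]; rewrite lee_fin mulr_ge0// ltW// X0.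
  + by apply/measurable_funTS/measurable_EFinP/measurable_funM.
  + by move=> w D'w; rewrite lee_fin stopped_cost_ge0//; exact: X0'.
  + by apply/measurable_funTS/measurable_EFinP; exact: mC.
  rewrite (IH _ _ c')// EFinD; congr (_ + _)%E; last by rewrite /c' -mulrA.
  under eq_integral do rewrite EFinM.
  rewrite ge0_integralZl//; last 2 first.
  + by apply/measurable_funTS/measurable_EFinP.
  + by move=> w [Dw _]; rewrite lee_fin ltW// X0.
  rewrite (integral_exponential_on_event (total_rate_gt0 G e) mD' _ _ PX)//;
    last first.
    by move=> w [Dw _]; rewrite ltW// X0.
  by rewrite -EFinM; congr EFin; ring.
rewrite sumEFin big_split/=; congr (_ + _)%:E.
rewrite -mulr_suml -mulr_sumr -mulr_suml -/(total_rate rate G) -mulrA.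
have [->|q0] := eqVneq (total_rate rate G) 0; first by rewrite invr0 !mulr0.
by rewrite divff// mul1r.
Qed.

End race_expectation.

(** * The linear system for the mean passage times *)

Section passage_times.
Variables (R : realType) (N : nat) (alpha lambda : R).
Hypotheses (alpha_gt0 : 0 < alpha) (lambda_gt0 : 0 < lambda).

Definition binom_sum (k : nat) : R :=
  \sum_(0 <= l < k.+1) 'C(N, k - l)%:R * (alpha / lambda) ^+ l.

(** The mean time to go from [k] to [k + 1] edges, [lambda] being the rate at
    which an absent edge appears. *)
Definition passage (k : nat) : R :=
  ((N - k - 1)`!)%:R * (k`!)%:R / (lambda * (N`!)%:R) * binom_sum k.

Definition passage_sum (i k : nat) : R := \sum_(k <= m < i) passage m.

Lemma binom_sumS k :
  binom_sum k.+1 = 'C(N, k.+1)%:R + alpha / lambda * binom_sum k.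
Proof.
rewrite /binom_sum big_nat_recl//= subn0 expr0 mulr1; congr (_ + _).
rewrite mulr_sumr; apply: eq_bigr => l _.
by rewrite subSS exprS mulrCA.
Qed.

Lemma binom_sum_ge0 k : 0 <= binom_sum k.
Proof.
apply: sumr_ge0 => l _; rewrite mulr_ge0// exprn_ge0// divr_ge0// ltW//.
Qed.

Lemma passage_ge0 k : 0 <= passage k.
Proof.
rewrite /passage mulr_ge0 ?binom_sum_ge0// divr_ge0// ?mulr_ge0// ltW//.
Qed.

(** Multiplying the closed formula by (N - k) lambda leaves binom_sum k divided
    by C(N, k), and [binom_sumS] splits off the term C(N, k), which yields the
    1; the remaining sum is k alpha times the previous passage time.  For
    [k = 0] the last term vanishes, whatever [k.-1] is. *)
Lemma passage_recurrence k : (k < N)%N ->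
  (N - k)%:R * lambda * passage k = 1 + k%:R * alpha * passage k.-1.
Proof.
move=> kN.
have N0 : (N`!)%:R != 0 :> R by rewrite pnatr_eq0 -lt0n fact_gt0.
have l0 : lambda != 0 by rewrite gt_eqF.
have -> : (N - k)%:R * lambda * passage k =
    ((N - k)`!)%:R * (k`!)%:R / (N`!)%:R * binom_sum k.
  rewrite /passage; have -> : ((N - k)`! = (N - k) * (N - k - 1)`!)%N.
    by rewrite subn1; move: kN; rewrite -subn_gt0; case: (N - k)%N.
  by rewrite natrM; field; rewrite N0.
have binE : ((N - k)`!)%:R * (k`!)%:R / (N`!)%:R * 'C(N, k)%:R = 1 :> R.
  have := bin_fact (ltnW kN); move/(congr1 (fun x => x%:R : R));
    rewrite !natrM => h.
  by rewrite mulrC mulrA (mulrC _%:R (k`!)%:R) h divff.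
case: k => [|k] /= in kN binE *.
  by rewrite /binom_sum big_nat1 subnn expr0 mulr1 binE !mul0r addr0.
rewrite binom_sumS mulrDr binE; congr (_ + _).
rewrite /passage; have -> : (N - k - 1 = N - k.+1)%N by rewrite -subnDA addn1.
by rewrite factS natrM; field; rewrite N0.
Qed.

Lemma passage_sum_ge0 i k : 0 <= passage_sum i k.
Proof. by apply: sumr_ge0 => m _; exact: passage_ge0. Qed.

Lemma passage_sum_recl i k : (k < i)%N ->
  passage_sum i k = passage k + passage_sum i k.+1.
Proof. by move=> ki; rewrite /passage_sum big_ltn. Qed.

Lemma passage_sum_le i k : (k <= i)%N -> passage_sum i k <= passage_sum i 0.
Proof.
move=> ki; rewrite [leRHS](big_cat_nat _ ki)//= lerDr.
by apply: sumr_ge0 => m _; exact: passage_ge0.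
Qed.

End passage_times.

Section mean_hitting.
Variables (R : realType) (E : finType) (alpha lambda : R).
Hypotheses (alpha_gt0 : 0 < alpha) (lambda_gt0 : 0 < lambda).
Variables (i : nat).
Hypothesis i_le : (i <= #|E|)%N.
Implicit Types (G : {set E}) (e : E).

Definition edge_rate (present : bool) : R := if present then alpha else lambda.

Notation g := (passage_sum #|E| alpha lambda i).
Notation q := (total_rate edge_rate).
Notation time := (mean_cost edge_rate i 1 0).
Notation reached := (mean_cost edge_rate i 0 1).

Lemma edge_rate_gt0 s : 0 < edge_rate s. Proof. by case: s. Qed.

Lemma card_toggle G e : #|toggle G e| = if e \in G then #|G|.-1 else #|G|.+1.
Proof.
have toggleE : toggle G e = if e \in G then G :\ e else e |: G.
  case: ifP => eG; apply/setP => x; rewrite !inE; case: eqVneq => [->|_];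
    by rewrite ?eG ?addbF ?addbT//=.
rewrite toggleE; case: ifP => eG; last by rewrite cardsU1 eG.
by rewrite (cardsD1 e G) eG.
Qed.

(** Seen through the number of edges, the jumps are those of a birth-death
    chain. *)
Lemma sum_rate_toggle G (v : nat -> R) :
  \sum_e edge_rate (e \in G) * v #|toggle G e| =
  (#|E| - #|G|)%:R * lambda * v #|G|.+1 + #|G|%:R * alpha * v #|G|.-1.
Proof.
rewrite (bigID (mem G))/= addrC; congr (_ + _).
- rewrite (eq_bigr (fun=> lambda * v #|G|.+1)); last first.
    by move=> e eG; rewrite card_toggle (negbTE eG).
  rewrite sumr_const -[LHS]mulr_natl mulrA; congr (_%:R * _ * _).
  by rewrite -(cardsC G) addKn; apply: eq_card => x; rewrite !inE.
- rewrite (eq_bigr (fun=> alpha * v #|G|.-1)); last first.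
    by move=> e eG; rewrite card_toggle eG.
  by rewrite sumr_const -[LHS]mulr_natl mulrA.
Qed.

Lemma total_rateE G : q G = (#|E| - #|G|)%:R * lambda + #|G|%:R * alpha.
Proof.
have := sum_rate_toggle G (fun=> 1); rewrite !mulr1 => <-.
by apply: eq_bigr => e _; rewrite mulr1.
Qed.

Lemma total_rate_bound G : q G <= #|E|%:R * (alpha + lambda).
Proof.
rewrite total_rateE addrC mulrDr lerD// ler_wpM2r ?ler_nat ?max_card
  ?leq_subr//.
all: exact: ltW.
Qed.

Lemma total_rate_gt0 G : (#|G| < i)%N -> 0 < q G.
Proof.
move=> Gi; rewrite total_rateE; apply: ltr_pwDl; last by rewrite mulr_ge0// ltW.
by rewrite mulr_gt0// ltr0n subn_gt0 (leq_trans Gi).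
Qed.

Lemma sum_jump_prob G : (#|G| < i)%N -> \sum_e edge_rate (e \in G) / q G = 1.
Proof. by move=> Gi; rewrite -mulr_suml divff// gt_eqF// total_rate_gt0. Qed.

Lemma jump_prob_ge0 G e : (#|G| < i)%N -> 0 <= edge_rate (e \in G) / q G.
Proof. by move=> Gi; rewrite divr_ge0// ltW ?edge_rate_gt0 ?total_rate_gt0. Qed.

(** The sums of one-step passage times solve the first-jump equation: by
    telescoping it reduces to [passage_recurrence] at the current number of
    edges. *)
Lemma passage_sum_first_jump G : (#|G| < i)%N ->
  g #|G| = (q G)^-1 + \sum_e edge_rate (e \in G) / q G * g #|toggle G e|.
Proof.
move=> Gi; have q0 : q G != 0 by rewrite gt_eqF// total_rate_gt0.
have -> : \sum_e edge_rate (e \in G) / q G * g #|toggle G e| =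
    (\sum_e edge_rate (e \in G) * g #|toggle G e|) / q G.
  by rewrite mulr_suml; apply: eq_bigr => e _; rewrite mulrAC.
rewrite sum_rate_toggle -[X in X + _]mul1r -mulrDl.
apply: (mulIf q0); rewrite divfK// total_rateE.
have rec := passage_recurrence alpha lambda_gt0 (leq_trans Gi i_le).
rewrite (passage_sum_recl _ _ _ Gi).
case: (posnP #|G|) rec => [->|G0] rec; first by move: rec; rewrite !mul0r; lra.
have := @passage_sum_recl R #|E| alpha lambda i #|G|.-1.
rewrite prednK// => /(_ (ltnW Gi)).
rewrite (passage_sum_recl _ _ _ Gi) => ->.
move: rec; set a := passage _ _ _ _.-1; set b := passage _ _ _ _;
  set c := passage_sum _ _ _ _ _.
lra.
Qed.

Lemma card_toggle_le G e : (#|G| < i)%N -> (#|toggle G e| <= i)%N.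
Proof.
move=> Gi; rewrite card_toggle; case: ifP => // _.
by rewrite (leq_trans (leq_pred _))// ltnW.
Qed.

Notation C := (g 0%N).
Notation Q := (#|E|%:R * (alpha + lambda)).

Lemma mean_reached_bounds m G : (#|G| <= i)%N -> 0 <= reached m G <= 1.
Proof.
elim: m G => [|m IH] G; rewrite leq_eqVlt /=; case: eqVneq => [_ _|_ /= Gi].
- by rewrite ler01 lexx.
- by rewrite lexx ler01.
- by rewrite ler01 lexx.
rewrite mul0r add0r sumr_ge0 => [|e _]; last first.
  by rewrite mulr_ge0 ?jump_prob_ge0//; case/andP: (IH _ (card_toggle_le e Gi)).
rewrite -[leRHS](sum_jump_prob Gi) ler_sum// => e _.
have /andP[_ s1] := IH _ (card_toggle_le e Gi).
by apply: ler_piMr => //; exact: jump_prob_ge0.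
Qed.

(** All three bounds pass through the first-jump recursion because the jump
    probabilities sum to 1.  The first two compare [time] with the solution [g]
    of the system.  The third says that each jump takes a mean time of at least
    1 / Q as long as the path is not stopped; with the first it makes the
    failure probability at most Q C / m. *)
Lemma mean_time_bounds m G : (#|G| <= i)%N ->
  [/\ time m G <= g #|G|,
      g #|G| - time m G <= C * (1 - reached m G) &
      m%:R * (1 - reached m G) <= Q * time m G].
Proof.
have C0 : 0 <= C by rewrite passage_sum_ge0.
elim: m G => [|m IH] G; rewrite leq_eqVlt /=; case: eqVneq => [->|_] //=.
- by rewrite /passage_sum big_geq// !subrr !mulr0.
- by move=> Gi; split; rewrite ?subr0 ?mulr1 ?mul0r ?mulr0 ?passage_sum_ge0
  ?passage_sum_le// ltnW.
- by rewrite /passage_sum big_geq// !subrr !mulr0.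
move=> Gi.
have p0 e := jump_prob_ge0 e Gi.
have B e := IH _ (card_toggle_le e Gi).
have gE := passage_sum_first_jump Gi.
have S1 := sum_jump_prob Gi.
rewrite div1r mul0r add0r.
set p := fun e => edge_rate (e \in G) / q G.
have failE : 1 - \sum_e p e * reached m (toggle G e) =
    \sum_e p e * (1 - reached m (toggle G e)).
  under [RHS]eq_bigr do rewrite mulrBr mulr1.
  by rewrite sumrB S1.
split.
- by rewrite gE lerD2l ler_sum// => e _; rewrite ler_wpM2l//; case: (B e).
- rewrite gE opprD addrACA subrr add0r -sumrB failE mulr_sumr ler_sum// => e _.
  by rewrite -mulrBr mulrCA ler_wpM2l//; case: (B e).
- set F := 1 - _.
  rewrite (mulrDr Q) -natr1 mulrDl mul1r addrC; apply: lerD.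
    rewrite /F (@le_trans _ _ 1)//.
      rewrite gerBl sumr_ge0// => e _; rewrite mulr_ge0//.
      by case/andP: (mean_reached_bounds m (card_toggle_le e Gi)).
    by rewrite ler_pdivlMr ?total_rate_gt0// mul1r total_rate_bound.
  rewrite /F failE !mulr_sumr ler_sum// => e _.
  rewrite mulrCA [leRHS]mulrCA; apply: ler_wpM2l; first exact: p0.
  by case: (B e).
Qed.

Lemma failure_le m G : (#|G| <= i)%N ->
  1 - reached m.+1 G <= Q * C * harmonic m.
Proof.
move=> Gi; have [tg _ st] := mean_time_bounds m.+1 Gi.
rewrite /harmonic /= ler_pdivlMr ?ltr0n// mulrC (le_trans st)// ler_wpM2l//.
  by rewrite mulr_ge0// addr_ge0 ?ltW.
by rewrite (le_trans tg)// passage_sum_le.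
Qed.

Lemma harmonicM_cvg0 (K : R) :
  (K * harmonic m @[m --> \oo] --> (0 : R))%classic.
Proof.
rewrite -[X in (_ --> X)%classic](mulr0 K); apply: cvgMr.
exact: cvg_harmonic.
Qed.

Lemma mean_reached_cvg G : (#|G| <= i)%N ->
  (reached m G @[m --> \oo] --> (1 : R))%classic.
Proof.
move=> Gi; rewrite -cvg_shiftS.
apply: (@squeeze_cvgr _ _ _ _ (fun m => 1 - Q * C * harmonic m) (fun=> 1)).
- apply: nearW => m; case/andP: (mean_reached_bounds m.+1 Gi) => _ ->.
  by rewrite andbT lerBlDr -lerBlDl failure_le.
- by rewrite -[X in (_ --> X)%classic](subr0 1); apply: cvgB;
  [exact: cvg_cst|exact: harmonicM_cvg0].
- exact: cvg_cst.
Qed.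

Lemma mean_time_cvg G : (#|G| <= i)%N ->
  (time m G @[m --> \oo] --> g #|G|)%classic.
Proof.
move=> Gi; rewrite -cvg_shiftS.
apply: (@squeeze_cvgr _ _ _ _ (fun m => g #|G| - C * (Q * C) * harmonic m)
  (fun=> g #|G|)).
- apply: nearW => m; have [tg gt _] := mean_time_bounds m.+1 Gi.
  rewrite tg andbT lerBlDr -lerBlDl (le_trans gt)// -mulrA ler_wpM2l//.
    by rewrite passage_sum_ge0.
  exact: failure_le.
- rewrite -[X in (_ --> X)%classic]subr0; apply: cvgB;
  [exact: cvg_cst|exact: harmonicM_cvg0].
- exact: cvg_cst.
Qed.

End mean_hitting.

(** * Sample paths *)

Section jumps.
Variable R : realType.
Implicit Types (h : nat -> R) (s t : R) (b : bool).

Lemma jump_timeS h k : jump_time h k.+1 = h 0%N + jump_time (h \o S) k.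
Proof. by rewrite /jump_time big_ord_recl. Qed.

Lemma jump_time0 h : jump_time h 0 = 0.
Proof. by rewrite /jump_time big_ord0. Qed.

Lemma edge_status_before b h t : 0 <= t < h 0%N -> edge_status b h t = b.
Proof.
move=> /andP[t0 th].
have h1 : jump_time h 1 = h 0%N by rewrite jump_timeS jump_time0 addr0.
rewrite /edge_status; case: (boolP b) => hb; last first.
  apply/negbTE/asboolPn => -[k [[jk _]]]; case: k jk => // k /(_ 1%N isT).
  by rewrite h1 leNgt th.
apply/asboolP; exists 0%N; split => //; split; last by rewrite h1.
by move=> l; rewrite leqn0 => /eqP->; rewrite jump_time0.
Qed.

(** After its first jump a pair is a pair in the opposite status, running on the
    remaining holding times. *)
Lemma edge_status_after b h t : 0 < h 0%N <= t ->
  edge_status b h t = edge_status (~~ b) (h \o S) (t - h 0%N).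
Proof.
move=> /andP[h0 ht].
have E k : jumps_by h t k.+1 <-> jumps_by (h \o S) (t - h 0%N) k.
  split=> -[jk kt]; split.
  - by move=> l lk; rewrite lerBrDl -jump_timeS; exact: jk.
  - by rewrite ltrBlDl -jump_timeS.
  - case=> [_|l lk]; first by rewrite jump_time0 (le_trans (ltW h0)).
    by rewrite jump_timeS -lerBrDl; exact: jk.
  - by rewrite jump_timeS -ltrBlDl.
rewrite /edge_status; apply/asboolP/asboolP => -[k [jk bk]].
  case: k jk bk => [[_]|k /E jk bk]; last by exists k; split => //;
    rewrite addNb -addbN.
  by rewrite jump_timeS jump_time0 addr0 ltNge ht.
by exists k.+1; split; [exact/E|rewrite /= addbN -addNb].
Qed.

(** Looking at a pair from a time [s] on shortens its current holding time by
    [s].  The identity holds even if the pair has jumped before [s], the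
    shortened time being then negative. *)
Lemma edge_status_delay b h s t : 0 <= s <= t ->
  edge_status b h t =
  edge_status b (fun k => if k == 0%N then h 0%N - s else h k) (t - s).
Proof.
move=> /andP[s0 st]; set h' := fun k => _.
have jE k : jump_time h' k.+1 = jump_time h k.+1 - s.
  by rewrite !jump_timeS /h'/= addrAC.
have E k : jumps_by h t k <-> jumps_by h' (t - s) k.
  split=> -[jk kt]; split.
  - case=> [_|l lk]; first by rewrite jump_time0 subr_ge0.
    by rewrite jE lerD2r; exact: jk.
  - by rewrite jE ltrD2r.
  - case=> [_|l lk]; first by rewrite jump_time0 (le_trans s0).
    by have := jk _ lk; rewrite jE lerD2r.
  - by move: kt; rewrite jE ltrD2r.
by rewrite /edge_status; apply/asboolP/asboolP => -[k [/E jk bk]]; exists k.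
Qed.

End jumps.

Section paths.
Variables (R : realType) (E : finType).
Implicit Types (G : {set E}) (h : E -> nat -> R) (e x : E).

Definition state_at G h (t : R) : {set E} :=
  [set x | edge_status (x \in G) (h x) t].

Lemma state_at_before G h t : 0 <= t -> (forall x, t < h x 0%N) ->
  state_at G h t = G.
Proof.
by move=> t0 th; apply/setP => x; rewrite inE edge_status_before// t0 th.
Qed.

(** The pathwise form of the regeneration at the first jump. *)
Lemma state_at_after G h e t : jumps_first h e -> 0 < h e 0%N <= t ->
  state_at G h t = state_at (toggle G e) (residual e h) (t - h e 0%N).
Proof.
move=> /jumps_firstP he /andP[h0 ht]; apply/setP => x; rewrite !inE.
rewrite /residual; case: eqVneq => [->|xe].
  by rewrite edge_status_after ?h0// addbT.
by rewrite addbF -edge_status_delay// (ltW h0).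
Qed.

Lemma jumps_first_inj h e x : jumps_first h e -> jumps_first h x -> e = x.
Proof.
move=> /jumps_firstP he /jumps_firstP hx; apply/eqP; apply: contraT => ex.
by have := lt_trans (hx _ ex) (he x _); rewrite eq_sym ltxx => /(_ ex).
Qed.

Lemma stopped_costS i kappa b m G h e : #|G| != i -> jumps_first h e ->
  stopped_cost i kappa b m.+1 G h =
  kappa * h e 0%N + stopped_cost i kappa b m (toggle G e) (residual e h).
Proof.
move=> /negbTE Gi he; rewrite /= Gi (bigD1 e)//= he mul1r big1 ?addr0// => x xe.
case: (boolP (jumps_first h x)) => hx; last by rewrite mul0r.
by move: xe; rewrite (jumps_first_inj hx he) eqxx.
Qed.

Lemma stopped_cost_none i kappa b m G h : #|G| != i ->
  (forall e, ~~ jumps_first h e) -> stopped_cost i kappa b m G h = 0.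
Proof.
move=> /negbTE Gi he; case: m => [|m] /=; rewrite Gi//.
by apply: big1 => e _; rewrite (negbTE (he e)) mul0r.
Qed.

Lemma stopped_cost_stop i kappa b m G h : #|G| = i ->
  stopped_cost i kappa b m G h = b.
Proof. by case: m => [|m] /= ->; rewrite eqxx. Qed.

Lemma jumps_first_dec h :
  {e | jumps_first h e} + {forall e, ~~ jumps_first h e}.
Proof.
case: (pickP (jumps_first h)) => [e he|he]; first by left; exists e.
by right => e; rewrite he.
Qed.

Lemma reached_le1 i m G h : stopped_cost i 0 1 m G h <= 1.
Proof.
elim: m G h => [|m IH] G h.
  by rewrite /=; case: ifP.
have [Gi|Gi] := eqVneq #|G| i; first by rewrite stopped_cost_stop.
have [[e he]|he] := jumps_first_dec h; last by rewrite stopped_cost_none.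
by rewrite (stopped_costS _ _ _ Gi he) mul0r add0r.
Qed.

Lemma elapsed_time_nondecreasing i m G h : (forall x k, 0 < h x k) ->
  stopped_cost i 1 0 m G h <= stopped_cost i 1 0 m.+1 G h.
Proof.
elim: m G h => [|m IH] G h h0.
  by rewrite [leLHS]/=; case: ifP => _; rewrite stopped_cost_ge0.
have [Gi|Gi] := eqVneq #|G| i; first by rewrite !stopped_cost_stop.
have [[e he]|he] := jumps_first_dec h; last by rewrite !stopped_cost_none.
by rewrite !(stopped_costS _ _ _ Gi he) lerD2l IH//; exact: residual_gt0.
Qed.

(** Once [i] edges are reached, allowing more jumps changes nothing. *)
Lemma stopped_cost_stable i kappa b m n G h : (m <= n)%N ->
  stopped_cost i 0 1 m G h != 0 ->
  stopped_cost i kappa b n G h = stopped_cost i kappa b m G h.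
Proof.
elim: m n G h => [|m IH] n G h mn.
  by rewrite /=; case: ifPn => [/eqP Gi _|];
    [rewrite stopped_cost_stop|rewrite eqxx].
have [Gi|Gi] := eqVneq #|G| i; first by rewrite !stopped_cost_stop.
have [[e he]|he] := jumps_first_dec h; last by rewrite stopped_cost_none ?eqxx.
case: n mn => // n mn.
by rewrite !(stopped_costS _ _ _ Gi he) mul0r add0r => /IH ->.
Qed.

(** By induction over the jumps: before the first one the graph is constant,
    after it the path is the path of the residual holding times. *)
Lemma elapsed_time_is_hit i m G h : (forall x k, 0 < h x k) ->
  stopped_cost i 0 1 m G h != 0 ->
  let t := stopped_cost i 1 0 m G h in
  #|state_at G h t| = i /\ forall s, 0 <= s < t -> #|state_at G h s| != i.
Proof.
elim: m G h => [|m IH] G h h0.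
  rewrite /=; case: ifPn => [/eqP Gi _|]; last by rewrite eqxx.
  split; first by rewrite state_at_before.
  by move=> s /andP[s0]; rewrite ltNge s0.
have [Gi|Gi] := eqVneq #|G| i.
  rewrite !stopped_cost_stop// => _; split; first by rewrite state_at_before.
  by move=> s /andP[s0]; rewrite ltNge s0.
have [[e he]|he] := jumps_first_dec h; last by rewrite stopped_cost_none ?eqxx.
rewrite !(stopped_costS _ _ _ Gi he) mul0r add0r mul1r.
move=> /(IH _ _ (residual_gt0 he h0)) [hit nohit].
have t0 := stopped_cost_ge0 i m (toggle G e) ler01 (lexx 0)
  (residual_gt0 he h0).
split.
  by rewrite (state_at_after _ he) ?h0 ?lerDl// addrC addKr.
move=> s /andP[s0 st]; have [hs|sh] := leP (h e 0%N) s.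
  rewrite (state_at_after _ he) ?h0//; apply: nohit.
  by rewrite subr_ge0 hs ltrBlDl.
rewrite state_at_before// => x; have [->//|xe] := eqVneq x e.
by rewrite (lt_trans sh)//; exact: (jumps_firstP _ _ he).
Qed.

(** Only positive times count for hitting, but as the initial graph does not
    have [i] edges the elapsed time is positive and the infimum is attained
    there. *)
Lemma hitting_time_elapsed i m G h : (forall x k, 0 < h x k) -> #|G| != i ->
  stopped_cost i 0 1 m G h != 0 ->
  ereal_inf
    [set t%:E | t in [set t : R | 0 < t /\ #|state_at G h t| = i]]%classic =
  (stopped_cost i 1 0 m G h)%:E.
Proof.
move=> h0 Gi reach; have [hit nohit] := elapsed_time_is_hit h0 reach.
set t := stopped_cost _ _ _ _ _ _ in hit nohit *.
have tge0 : 0 <= t by exact: stopped_cost_ge0.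
have t0 : 0 < t.
  rewrite lt_neqAle tge0 andbT eq_sym; apply: contraNneq Gi => t0.
  by move: hit; rewrite t0 state_at_before// => ->.
apply/eqP; rewrite eq_le; apply/andP; split.
  by apply: ereal_inf_lbound; exists t.
apply/ereal_infP => _ [s [s0 hs] <-]; rewrite lee_fin leNgt; apply/negP => st.
by have := nohit s; rewrite (ltW s0) st hs eqxx => /(_ isT).
Qed.

End paths.

(** * The mean hitting time *)

Section integral_almost_everywhere.
Local Open Scope classical_set_scope.
Local Open Scope ereal_scope.
Variables (R : realType) (d : measure_display) (T : measurableType d).
Variable mu : {measure set T -> \bar R}.

(** The integral of a nonnegative function is a supremum over the simple
    functions below it, which grows with the function, measurable or not. *)
Lemma ge0_le_integralT (f g : T -> \bar R) :
  (forall w, 0 <= f w) -> (forall w, f w <= g w) ->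
  \int[mu]_w f w <= \int[mu]_w g w.
Proof.
move=> f0 fg; have g0 w : 0 <= g w by exact: le_trans (fg w).
rewrite !ge0_integralTE//; apply: ereal_sup_le => _ [h hf <-]; exists h => //.
by move=> w; apply: le_trans (fg w).
Qed.

(** Off [A] the function may fail to be measurable, so it cannot simply be
    split.  It lies between its extensions from [A] by 0 and by infinity, which
    are measurable and have the same integral. *)
Lemma ge0_integral_full (A : set T) (f : T -> \bar R) :
  measurable A -> mu (~` A) = 0 -> (forall w, 0 <= f w) -> measurable_fun A f ->
  \int[mu]_w f w = \int[mu]_(w in A) f w.
Proof.
move=> mA A0 f0 mf; pose g w := if w \in A then f w else +oo.
have mAC : measurable (~` A) by exact: measurableC.
have gA : {in A, g =1 f} by move=> w wA; rewrite /g wA.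
have mg : measurable_fun setT g.
  rewrite -(setUv A); apply/measurable_funU => //; split.
    by apply: (eq_measurable_fun f) => // w wA; rewrite gA.
  apply: (eq_measurable_fun (cst +oo)) => // w; rewrite inE => nA.
  by rewrite /g memNset.
apply/eqP; rewrite eq_le; apply/andP; split.
  apply: (@le_trans _ _ (\int[mu]_w g w)).
    by apply: ge0_le_integralT => // w; rewrite /g; case: ifP => // _;
      rewrite leey.
  rewrite (ge0_negligible_integral mAC measurableT mg _ A0); last first.
    by move=> w _; rewrite /g; case: ifP.
  rewrite setTD setCK le_eqVlt; apply/orP; left; apply/eqP.
  exact: eq_integral.
rewrite integral_mkcond; apply: ge0_le_integralT => w.
  by rewrite patchE; case: ifP.
by rewrite patchE; case: ifP.
Qed.

End integral_almost_everywhere.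

Section mean_hitting_time.
Local Open Scope classical_set_scope.
Variables (R : realType) (d : measure_display) (T : measurableType d).
Variables (P : probability T R) (E : finType) (alpha lambda : R).
Hypotheses (alpha_gt0 : (0 < alpha)%R) (lambda_gt0 : (0 < lambda)%R).
Variables (G0 : {set E}) (H : E -> nat -> T -> R).
Hypothesis mH : forall x k, measurable_fun setT (H x k).
Notation rho := (status_rate (edge_rate alpha lambda) G0).
Hypothesis indH : independent_exponentials P setT 1 (fun ek => H ek.1 ek.2) rho.

(* The holding times are positive on D, which is a full event but need not be
   the whole space. *)
Let D := [set w | forall x k, (0 < H x k w)%R].

Lemma rho_gt0 ek : 0 < rho ek. Proof. exact: edge_rate_gt0. Qed.

Lemma holding_law x k (A : set R) : measurable A ->
  P (H x k @^-1` A) = exponential_prob (rho (x, k)) A.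
Proof.
move=> mA; have := indH (J := [:: (x, k)]) (A := fun=> A) isT (fun=> mA).
rewrite setTI big_seq1 mul1e => <-; congr (P _).
apply/seteqP; split => w /=; first by move=> Aw i; rewrite /= inE => /eqP->.
by move/(_ (x, k)); apply; rewrite /= inE.
Qed.

Lemma measurable_positive : measurable D.
Proof.
have -> : D = \bigcap_(x in [set: E]) \bigcap_k [set w | 0 < H x k w].
  by apply/seteqP; split => w h => [x _ k _|x k]; [exact: h|exact: (h x I k I)].
apply: fin_bigcap_measurable => // x _; apply: bigcapT_measurable => k.
have -> : [set w | 0 < H x k w] = H x k @^-1` `]0, +oo[.
  by apply/seteqP; split => w /=; rewrite in_itv/= andbT.
by rewrite -[X in measurable X]setTI; exact: mH.
Qed.

Lemma positive_full : P (~` D) = 0%E.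
Proof.
pose bad n := if @unpickle (E * nat)%type n is Some xk
  then H xk.1 xk.2 @^-1` `]-oo, 0%R] else set0.
have -> : ~` D = \bigcup_n bad n.
  apply/seteqP; split => w; last first.
    move=> [n _]; rewrite /bad; case: unpickle => // -[x k] /= + Dw.
    by rewrite in_itv/= leNgt (Dw x k).
  move=> /= /existsNP[x /existsNP[k /negP]]; rewrite -leNgt => Hw.
  by exists (pickle (x, k)) => //; rewrite /bad pickleK /= in_itv.
have mbad n : measurable (bad n).
  rewrite /bad; case: unpickle => // -[x k].
  by rewrite -[X in measurable X]setTI; exact: mH.
apply/eqP; rewrite eq_le measure_ge0 andbT.
apply: (le_trans (measure_sigma_subadditive _ mbad _ (@subset_refl _ _))).
  exact: bigcup_measurable.
rewrite eseries0// => n _ _; rewrite /bad; case: unpickle => [[x k]|];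
  last exact: measure0.
rewrite [LHS](holding_law x k)//.
exact: exponential_prob_nonpos (rho_gt0 (x, k)).
Qed.

Lemma probability_positiveI (B : set T) : measurable B -> P (D `&` B) = P B.
Proof.
move=> mB; have mD := measurable_positive.
rewrite -[in RHS](setIT B) -(setUv D) setIUr measureU; last 3 first.
- exact: measurableI.
- by apply: measurableI => //; exact: measurableC.
- by rewrite setIACA setICr setI0.
rewrite [X in (_ + X)%E](_ : _ = 0%E); first by rewrite adde0 setIC.
apply: (subset_measure0 _ _ (@subIsetr _ _ _) positive_full) => //.
  by apply: measurableI => //; exact: measurableC.
exact: measurableC.
Qed.

Lemma independent_positive :
  independent_exponentials P D 1 (fun ek => H ek.1 ek.2) rho.
Proof.
move=> J A uJ mA; rewrite probability_positiveI; last first.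
  apply: fin_bigcap_measurable => // ek _.
  by rewrite -[X in measurable X]setTI; exact: mH.
by rewrite -(indH uJ mA) setTI.
Qed.

Variable i : nat.
Hypotheses (G0_lt : (#|G0| < i)%N) (i_le : (i <= #|E|)%N).

Let elapsed m w := stopped_cost i 1 0 m G0 (sample H w).
Let reached m w := stopped_cost i 0 1 m G0 (sample H w).
(* The good paths: positive holding times, and i edges reached without a tie in
   finitely many jumps. *)
Let A := D `&` \bigcup_m [set w | reached m w != 0].

Let measurable_elapsed m : measurable_fun setT (elapsed m).
Proof. exact: measurable_stopped_cost. Qed.

Let measurable_reached m : measurable_fun setT (reached m).
Proof. exact: measurable_stopped_cost. Qed.

Let measurable_A : measurable A.
Proof.
apply: measurableI; first exact: measurable_positive.
apply: bigcupT_measurable => m.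
have -> : [set w | reached m w != 0] = reached m @^-1` (~` [set 0]).
  by apply/seteqP; split => w /= /eqP.
rewrite -[X in measurable X]setTI; apply: measurable_reached => //.
by apply: measurableC; exact: measurable_set1.
Qed.

Let integral_over_D kappa b m : 0 <= kappa -> 0 <= b ->
  (\int[P]_(w in D) (stopped_cost i kappa b m G0 (sample H w))%:E =
   (mean_cost (edge_rate alpha lambda) i kappa b m G0)%:E)%E.
Proof.
move=> kappa0 b0.
rewrite (integral_stopped_cost (edge_rate_gt0 alpha_gt0 lambda_gt0) _ _
  kappa0 b0 measurable_positive mH _ independent_positive) ?mul1r//.
Qed.

(* The probability of A is at least that of reaching i edges within m jumps, for
   each m, and these tend to 1. *)
Let A_full : P (~` A) = 0%E.
Proof.
have fPA : P A \is a fin_num by rewrite fin_num_measure.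
suff : (1 <= P A)%E.
  by move=> PA; apply/eqP; rewrite eq_le measure_ge0 andbT probability_setC//
    sube_le0.
rewrite -(fineK fPA) lee_fin.
apply: (cvgr_to_le (mean_reached_cvg alpha_gt0 lambda_gt0 i_le (ltnW G0_lt))).
apply: nearW => m; rewrite -lee_fin fineK// -integral_over_D//.
rewrite (_ : P A = \int[P]_(w in D) (\1_A w)%:E)%E; last first.
  rewrite integral_indic//; last exact: measurable_positive.
  by rewrite setIidl// => w [].
apply: ge0_le_integral => //.
- exact: measurable_positive.
- by move=> w Dw; rewrite lee_fin stopped_cost_ge0.
- by apply/measurable_funTS/measurable_EFinP; exact: measurable_reached.
- by apply/measurable_funTS/measurable_EFinP/measurable_indic.
move=> w Dw; rewrite lee_fin indicE.
have [->|sm] := eqVneq (stopped_cost i 0 1 m G0 (sample H w)) 0;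
  first by rewrite ler0n.
by rewrite mem_set ?reached_le1//; split => //; exists m.
Qed.

(** On the good paths the hitting time is the increasing limit of the times
    elapsed at the m-th jump, and their means tend to the solution of the
    first-jump equation. *)
Theorem mean_hitting_time (hit : T -> \bar R) :
  (forall w, hit w = ereal_inf
      [set t%:E | t in
        [set t : R | 0 < t /\ #|state_at G0 (sample H w) t| = i]]) ->
  (\int[P]_w hit w = (passage_sum #|E| alpha lambda i #|G0|)%:E)%E.
Proof.
move=> hitE.
have mD := measurable_positive.
have G0i : #|G0| != i by rewrite neq_ltn G0_lt.
have elapsed_nd w : D w -> nondecreasing_seq (elapsed ^~ w).
  move=> Dw; apply/nondecreasing_seqP => k.
  exact: elapsed_time_nondecreasing.
have hit_cvg w : A w -> (elapsed m w)%:E @[m --> \oo] --> hit w.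
  move=> [Dw [m _ sm]]; rewrite hitE (hitting_time_elapsed _ G0i sm)//.
  apply: cvg_near_cst; exists m => // n /= mn.
  by rewrite /elapsed (stopped_cost_stable _ _ mn sm).
have hit_lim w : A w -> hit w = limn (fun m => (elapsed m w)%:E).
  by move=> Aw; apply/esym/cvg_lim => //; exact: hit_cvg.
have elapsed_cvg : (\int[P]_(w in A) (elapsed m w)%:E @[m --> \oo] -->
    \int[P]_(w in A) limn (fun m => (elapsed m w)%:E))%E.
  apply: cvg_monotone_convergence => //.
  - by move=> m; apply/measurable_funTS/measurable_EFinP.
  - by move=> m w [Dw _]; rewrite lee_fin stopped_cost_ge0.
  - by move=> w [Dw _] m n mn; rewrite lee_fin elapsed_nd.
rewrite (ge0_integral_full measurable_A A_full); last 2 first.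
- move=> w; rewrite hitE; apply/ereal_infP => _ [t [t0 _] <-].
  by rewrite lee_fin ltW.
- apply: (emeasurable_fun_cvg (fun m w => (elapsed m w)%:E)) => // m.
  by apply/measurable_funTS/measurable_EFinP.
rewrite (eq_integral (fun w => limn (fun m => (elapsed m w)%:E))); last first.
  by move=> w; rewrite inE; exact: hit_lim.
apply/esym; apply: (cvg_unique _ _ elapsed_cvg) => //.
have -> : (fun m => \int[P]_(w in A) (elapsed m w)%:E)%E =
   fun m => (mean_cost (edge_rate alpha lambda) i 1 0 m G0)%:E.
  apply/funext => m; rewrite -integral_over_D//.
  rewrite [RHS](ge0_negligible_integral (N := ~` A))//; last 3 first.
  - exact: measurableC.
  - by apply/measurable_funTS/measurable_EFinP; exact: measurable_elapsed.
  - by move=> w Dw; rewrite lee_fin stopped_cost_ge0.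
  by rewrite setDE setCK setIidr// => w [].
apply: cvg_EFin; first exact: nearW.
exact: (mean_time_cvg alpha_gt0 lambda_gt0 i_le (ltnW G0_lt)).
Qed.

End mean_hitting_time.

(** * The dynamic random graph *)

Lemma card_vpair n : #|{: vpair n}| = 'C(n, 2).
Proof.
rewrite card_sig -[n in RHS]card_ord -card_draws cardsE.
by apply: eq_card => A; rewrite !inE.
Qed.

Lemma mean_hitting_time_ER (R : realType) (alpha beta : R) (n : nat)
    (d : measure_display) (T : measurableType d) (P : probability T R)
    (G0 : {set vpair n}) (X : R -> T -> {set vpair n}) (i : nat) :
  0 < alpha -> 0 < beta -> (2 <= n)%N ->
  dynamic_ER P alpha beta G0 X -> (#|G0| < i <= 'C(n, 2))%N ->
  (\int[P]_w hitting_time X i w =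
   (passage_sum 'C(n, 2) alpha (beta / (n%:R - 1)) i #|G0|)%:E)%E.
Proof.
move=> alpha_gt0 beta_gt0 hn [H [indH lawH XE]] /andP[G0i iN].
have n1 : 0 < n%:R - 1 :> R by rewrite subr_gt0 ltr1n.
have lambda_gt0 : 0 < beta / (n%:R - 1) by rewrite divr_gt0.
rewrite -card_vpair in iN *.
apply: (mean_hitting_time alpha_gt0 lambda_gt0 (H := fun x k => H x k)) => //.
  move=> J A uJ mA; rewrite setTI mul1e indH//.
  by apply: eq_bigr => -[x k] _; exact: lawH.
move=> w; rewrite /hitting_time; congr (ereal_inf [set _ | _ in _]).
apply/seteqP; split => t /= [t0 ht]; split => //; rewrite -ht;
  apply: eq_card => x.
  by rewrite !inE XE// ltW.
by rewrite !inE XE// ltW.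
Qed.

Lemma passage_ER (R : realType) (alpha beta : R) (n N m : nat) :
  0 < beta -> (2 <= n)%N ->
  passage N alpha (beta / (n%:R - 1)) m =
  (n%:R - 1) * ((N - m - 1)`!)%:R * (m`!)%:R / (beta * (N`!)%:R) *
  \sum_(0 <= k < m.+1) 'C(N, m - k)%:R * (alpha / beta * (n%:R - 1)) ^+ k.
Proof.
move=> beta_gt0 hn; have n1 : n%:R - 1 != 0 :> R by rewrite subr_eq0 pnatr_eq1;
  case: n hn => [|[]].
have N0 : (N`!)%:R != 0 :> R by rewrite pnatr_eq0 -lt0n fact_gt0.
have b0 : beta != 0 by rewrite gt_eqF.
have rhoE : alpha / (beta / (n%:R - 1)) = alpha / beta * (n%:R - 1).
  by field; rewrite n1 b0.
by rewrite /passage /binom_sum rhoE; congr (_ * _); field; rewrite ?N0 ?n1 ?b0.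
Qed.

Theorem proposition1 (R : realType) (alpha beta : R) (n N : nat)
    (halpha : 0 < alpha) (hbeta : 0 < beta) (hn : (2 <= n)%N)
    (hN : N = 'C(n, 2)) :
  (forall (i : nat), (i <= N - 1)%N ->
   forall (d : measure_display) (T : measurableType d) (P : probability T R)
     (G0 : {set vpair n}) (X : R -> T -> {set vpair n}),
     #|G0| = i -> dynamic_ER P alpha beta G0 X ->
     (\int[P]_w hitting_time X i.+1 w)%E =
     ((n%:R - 1) * ((N - i - 1)`!)%:R * (i`!)%:R / (beta * (N`!)%:R) *
      \sum_(0 <= k < i.+1)
        'C(N, i - k)%:R * (alpha / beta * (n%:R - 1)) ^+ k)%:E)
  /\
  (forall (i j : nat), (j < i)%N -> (i <= N)%N ->
   forall (d : measure_display) (T : measurableType d) (P : probability T R)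
     (G0 : {set vpair n}) (X : R -> T -> {set vpair n}),
     #|G0| = j -> dynamic_ER P alpha beta G0 X ->
     (\int[P]_w hitting_time X i w)%E =
     (\sum_(j <= m < i)
        (n%:R - 1) * ((N - m - 1)`!)%:R * (m`!)%:R / (beta * (N`!)%:R) *
        \sum_(0 <= k < m.+1)
          'C(N, m - k)%:R * (alpha / beta * (n%:R - 1)) ^+ k)%:E).
Proof.
have N_gt0 : (0 < N)%N by rewrite hN bin_gt0.
split=> [i iN|i j ji iN] d T P G0 X G0E dyn.
  rewrite (mean_hitting_time_ER halpha hbeta hn dyn); last first.
    by rewrite G0E -hN ltnSn -(prednK N_gt0) ltnS -subn1.
  by rewrite -hN G0E /passage_sum big_nat1 passage_ER.
rewrite (mean_hitting_time_ER halpha hbeta hn dyn); last by rewrite G0E ji -hN.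
by rewrite -hN G0E; congr EFin; apply: eq_bigr => m _; rewrite passage_ER.
Qed.
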